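(* Let $\mathbb F$ be an algebraically closed field of characteristic zero and let $q\in\mathbb F$ be nonzero and not a root of unity. Let $A,A^*$ be a $q$-geometric tridiagonal pair over $\mathbb F$ with diameter $d$, and let $\hat P$ be its normalized Drinfel'd polynomial. Then $$\hat P(\lambda)=(-1)^d([d]^!_q)^2(q-q^{-1})^{2d}\lambda^d\,P_{A,A^*}\bigl(\lambda^{-1}q^{-1}(q-q^{-1})^{-2}\bigr),$$ where $$P_{A,A^*}(\lambda)=\sum_{i=0}^d\frac{(-1)^i\zeta_iq^i\lambda^i}{([i]^!_q)^2}$$ and $\{\zeta_i\}_{i=0}^d$ is the split sequence of $A,A^*$ associated with the standard ordering $\{q^{2i-d}\}_{i=0}^d$ of the eigenvalues of $A$ and the standard ordering $\{q^{d-2i}\}_{i=0}^d$ of the eigenvalues of $A^*$.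
   Context: Notation: $[n]_q=\frac{q^n-q^{-n}}{q-q^{-1}}$ and $[n]^!_q=[n]_q[n-1]_q\cdots[1]_q$ for integers $n\ge0$, with $[0]^!_q=1$. Let $V$ be a vector space over $\mathbb F$ of finite positive dimension. A tridiagonal pair on $V$ is an ordered pair of $\mathbb F$-linear maps $A,A^*:V\to V$ ($A^*$ is just a name, not an adjoint) such that: (i) both are diagonalizable; (ii) the eigenspaces of $A$ can be ordered $V_0,\dots,V_d$ with $A^*V_i\subseteq V_{i-1}+V_i+V_{i+1}$ ($0\le i\le d$, $V_{-1}=V_{d+1}=0$); (iii) the eigenspaces of $A^*$ can be ordered $V^*_0,\dots,V^*_\delta$ with $AV^*_i\subseteq V^*_{i-1}+V^*_i+V^*_{i+1}$ ($0\le i\le\delta$, $V^*_{-1}=V^*_{\delta+1}=0$); (iv) no subspace $W\ne 0,V$ satisfies $AW\subseteq W$ and $A^*W\subseteq W$. It is known that $d=\delta$ (the diameter) and $\dim V_i=\dim V^*_i=\dim V_{d-i}$. Orderings as in (ii), (iii), and the corresponding orderings of eigenvalues, are called standard; the reversal of a standard ordering is standard, and there are no other standard orderings. Since $\mathbb F$ is algebraically closed, it is known that $\dim V_0=\dim V_0^*=1$ (the pair is sharp). The pair is $q$-geometric if $\{q^{d-2i}\}_{i=0}^d$ is a standard ordering of the eigenvalues of $A$ and of the eigenvalues of $A^*$. Given standard orderings $\{\theta_i\}_{i=0}^d$, $\{\theta^*_i\}_{i=0}^d$ of the eigenvalues of $A$, $A^*$ (with corresponding eigenspaces $V_i,V^*_i$),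 the line $V^*_0$ is known to be invariant under $(A^*-\theta^*_1I)\cdots(A^*-\theta^*_iI)(A-\theta_{i-1}I)\cdots(A-\theta_0I)$ for $0\le i\le d$; $\zeta_i$ is the corresponding eigenvalue and $\{\zeta_i\}_{i=0}^d$ is the split sequence associated with these orderings ($\zeta_0=1$). Base $\beta$ of a tridiagonal pair: for $d\ge3$, $\beta+1$ is the common value of $\frac{\theta_{i-2}-\theta_{i+1}}{\theta_{i-1}-\theta_i}$ and $\frac{\theta^*_{i-2}-\theta^*_{i+1}}{\theta^*_{i-1}-\theta^*_i}$ for $2\le i\le d-1$; for $d\le 2$ the base is a chosen scalar. A $q$-geometric pair has $\beta=q^2+q^{-2}$ when $d\ge3$, and for $d\le2$ the base is taken to be $q^2+q^{-2}$; thus the pair is of type I ($\beta\ne\pm2$). Normalized Drinfel'd polynomial (type I), formed with the present $q$: choose standard orderings $\{\theta_i\}$, $\{\theta^*_i\}$ with split sequence $\{\zeta_i\}$; write $\theta_i=a+bq^{2i-d}+cq^{d-2i}$, $\theta^*_i=a^*+b^*q^{2i-d}+c^*q^{d-2i}$ for $0\le i\le d$ (the scalars are unique if $d\ge2$; for $d\le1$ one takes $a=0,b=1,c=0$ for the ordering $\{q^{2i-d}\}$ of the eigenvalues of $A$ and $a=0,b=0,c=1$ for $\{q^{d-2i}\}$, and likewise for $a^*,b^*,c^*$ and the eigenvalues of $A^*$); put $\hat p_i=(q^i-q^{-i})^2(bb^*q^{2i-2d}+cc^*q^{2d-2i}-\lambda)$ for $1\le i\le d$ and $\hat P=\sum_{i=0}^d\zeta_i\,\hat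 p_{i+1}\hat p_{i+2}\cdots\hat p_d\in\mathbb F[\lambda]$. This polynomial does not depend on the choice of standard orderings, and is called the normalized Drinfel'd polynomial of $A,A^*$. *)

(* Defs.v *)
From mathcomp Require Import all_boot all_order all_algebra.

Set Implicit Arguments.
Unset Strict Implicit.
Unset Printing Implicit Defensive.

Import GRing.Theory passmx.
Local Open Scope ring_scope.

Section QIntegers.
Variables (F : fieldType) (q : F).

Definition qint (n : nat) : F := (q ^+ n - q ^- n) / (q - q^-1).

Definition qfact (n : nat) : F := \prod_(1 <= k < n.+1) qint k.

End QIntegers.

Section TridiagonalPairs.
Variables (F : fieldType) (V : vectType F).

Definition ldiagonalizable (f : 'End(V)) : Prop :=
  exists2 X : seq V, basis_of fullv X &
    forall v, v \in X -> exists a, v \in leigenspace f a.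

(* Sequences theta_0, ..., theta_d are functions on nat of which only the     *)
(* values at indices i <= d matter.  The range |i - j| <= 1, 0 <= j <= d of   *)
(* the sum below accounts for the convention V_{-1} = V_{d+1} = 0.            *)
Definition standard_ordering (A B : 'End(V)) (d : nat) (theta : nat -> F) :
    Prop :=
  [/\ forall i j, (i <= d)%N -> (j <= d)%N -> theta i = theta j -> i = j,
      forall x, leigenvalue A x <-> exists2 i, (i <= d)%N & theta i = x
    & forall i, (i <= d)%N ->
        (B @: leigenspace A (theta i) <=
           \sum_(j < d.+1 | (i <= j.+1)%N && (j <= i.+1)%N)
              leigenspace A (theta j))%VS].

Definition irreducible_pair (A As : 'End(V)) : Prop :=
  forall W : {vspace V},
    (A @: W <= W)%VS -> (As @: W <= W)%VS -> W = 0%VS \/ W = fullv.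

Definition tridiagonal_pair (A As : 'End(V)) : Prop :=
  (0 < \dim {:V})%N /\
  [/\ ldiagonalizable A /\ ldiagonalizable As,
      exists d theta, standard_ordering A As d theta,
      exists delta thetas, standard_ordering As A delta thetas
    & irreducible_pair A As].

(* The standard orderings below have length d + 1, so that d is the diameter. *)
Definition q_geometric (q : F) (d : nat) (A As : 'End(V)) : Prop :=
  [/\ tridiagonal_pair A As,
      standard_ordering A As d (fun i => q ^ (d%:Z - (2 * i)%N%:Z))
    & standard_ordering As A d (fun i => q ^ (d%:Z - (2 * i)%N%:Z))].

(* (As - theta*_1) ... (As - theta*_i) (A - theta_{i-1}) ... (A - theta_0)    *)
Definition split_operator (A As : 'End(V)) (theta thetas : nat -> F)
    (i : nat) : 'End(V) :=
  (\big[@comp_lfun F V V V / (\1)%VF]_(1 <= j < i.+1) (As - thetas j *: \1%VF) \o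
   \big[@comp_lfun F V V V / (\1)%VF]_(j <- rev (iota 0 i)) (A - theta j *: \1%VF))%VF.

Definition split_sequence (A As : 'End(V)) (d : nat)
    (theta thetas zeta : nat -> F) : Prop :=
  forall i, (i <= d)%N -> forall v, v \in leigenspace As (thetas 0%N) ->
    split_operator A As theta thetas i v = zeta i *: v.

(* For d <= 1 the first condition does not determine (a, b, c), and one of    *)
(* the two conventional triples is imposed; the first condition then forces   *)
(* theta_i = q^{2i-d} for (0, 1, 0) and theta_i = q^{d-2i} for (0, 0, 1).     *)
Definition type_I_coefs (q : F) (d : nat) (theta : nat -> F) (a b c : F) :
    Prop :=
  (forall i, (i <= d)%N ->
     theta i = a + b * q ^ ((2 * i)%N%:Z - d%:Z)
                 + c * q ^ (d%:Z - (2 * i)%N%:Z)) /\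
  ((d <= 1)%N -> [/\ a = 0, b = 1 & c = 0] \/ [/\ a = 0, b = 0 & c = 1]).

Definition phat (q : F) (d : nat) (b c bs cs : F) (i : nat) : {poly F} :=
  ((q ^+ i - q ^- i) ^+ 2)%:P *
  ((b * bs * q ^ ((2 * i)%N%:Z - (2 * d)%N%:Z)
    + c * cs * q ^ ((2 * d)%N%:Z - (2 * i)%N%:Z))%:P - 'X).

(* Phat may be formed from any choice of standard orderings; that all choices *)
(* give the same polynomial is a theorem and is not assumed here.             *)
Definition normalized_Drinfeld (q : F) (d : nat) (A As : 'End(V))
    (Phat : {poly F}) : Prop :=
  exists theta thetas zeta : nat -> F,
    [/\ standard_ordering A As d theta,
        standard_ordering As A d thetas,
        split_sequence A As d theta thetas zeta
      & exists a b c as_ bs cs : F,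
          [/\ type_I_coefs q d theta a b c,
              type_I_coefs q d thetas as_ bs cs
            & Phat = \sum_(i < d.+1)
                (zeta i)%:P * \prod_(i.+1 <= j < d.+1) phat q d b c bs cs j]].

End TridiagonalPairs.

Definition geometric_Drinfeld (F : fieldType) (q : F) (d : nat)
    (zeta : nat -> F) : {poly F} :=
  \poly_(i < d.+1) ((-1) ^+ i * zeta i * q ^+ i / qfact q i ^+ 2).

(* Constants and variable of the field of rational functions F(X).            *)
Definition ratC (F : fieldType) (c : F) : {fraction {poly F}} := tofrac c%:P.

Definition ratX (F : fieldType) : {fraction {poly F}} := tofrac 'X.

(* Main.v *)
Require Import Defs.
From mathcomp Require Import all_boot all_order all_algebra.
From mathcomp Require Import ring zify.
Import GRing.Theory passmx.
Local Open Scope ring_scope.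

Set Implicit Arguments.
Unset Strict Implicit.
Unset Printing Implicit Defensive.

(** Write theta_i = q^{2i-d} and theta*_i = q^{d-2i}.  For these orderings
    b b* = c c* = 0, so the Drinfeld polynomial they produce is
    sum_i zeta_i prod_{j>i} (- (q^j - q^-j)^2 lambda), and the announced formula
    is a rescaling of it ([Drinfeld_sum0_fraction]).  The point is therefore that
    every other admissible choice of standard orderings gives the same
    polynomial.

    There are at most four choices: irreducibility forces consecutive eigenspaces of
    any standard ordering to be linked by As, so that an ordering is determined
    up to reversal ([standard_ordering_unique]).  It remains to reverse one
    ordering at a time.

    Reversing theta leaves the space V*_0 alone.  Up to explicit nonzero factors,
    zeta_i is the scalar by which e*(As) tau_i(A) acts on V*_0, where
    tau_i = (x - theta_0) ... (x - theta_{i-1}) and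
    e* = (x - theta*_1) ... (x - theta*_d) is proportional to the projection
    polynomial of V*_0 ([compressE]).  Hence f |-> e*(As) f(A) on V*_0 is a
    scalar-valued linear functional on polynomials of degree at most d, and both
    split sequences are its values on two Newton bases.  The Drinfeld polynomial
    is its value at a polynomial which is the same for the two bases, by an
    identity proved by telescoping ([reversal_identity],
    [Drinfeld_sum_reverse]).

    Reversing theta* replaces V*_0 by V*_d.  The two are compared through V_0:
    the split sequence of (As, A) is that of (A, As) ([split_dual]), which turns
    the reversal of theta* into the previous case.  With
    e = (x - theta_1) ... (x - theta_d) and v in V*_0 one has
      e(A) tau*_j(As) tau_i(A) v = delta_{ij} zeta_i e(A) v,
    and expanding e in the tau_i computes e(A) tau*_i(As) on e(A) V*_0.  This
    space is all of V_0: the sum over i of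
    (V*_0 + ... + V*_i) cap (V_i + ... + V_d) is invariant under A and As, hence
    equals V, and is contained in V*_0 + V_1 + ... + V_d ([eigenspace0_plus_tail]). *)

(** * Polynomials in an endomorphism *)

(** Evaluation of p at B, written as an explicit sum because endomorphisms form a
    nontrivial ring only when V is nonzero. *)
Definition lhorner (F : fieldType) (V : vectType F) (B : 'End(V))
    (p : {poly F}) : 'End(V) :=
  \sum_(i < size p) p`_i *: iter i (fun f => (B \o f)%VF) \1%VF.

(** For a sequence of eigenvalues, [linfac theta 0 i] is the Newton polynomial
    tau_i, and [linfac theta 1 d.+1] is proportional to the polynomial that
    projects onto the eigenspace of index 0. *)
Definition linfac (F : fieldType) (theta : nat -> F) (m n : nat) : {poly F} :=
  \prod_(m <= j < n) ('X - (theta j)%:P).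

Definition espan (F : fieldType) (V : vectType F) (B : 'End(V))
    (theta : nat -> F) (d : nat) (P : pred nat) : {vspace V} :=
  (\sum_(j < d.+1 | P j) leigenspace B (theta j))%VS.

Section LHorner.
Variables (F : fieldType) (V : vectType F).
Implicit Types (B : 'End(V)) (p : {poly F}) (v : V).

Lemma lhorner_wide B p n v : (size p <= n)%N ->
  lhorner B p v = \sum_(i < n) p`_i *: iter i B v.
Proof.
move=> le_pn; rewrite /lhorner sum_lfunE.
have iterE i : iter i (fun f => (B \o f)%VF) \1%VF v = iter i B v.
  by elim: i => [|i IHi] /=; rewrite ?id_lfunE // comp_lfunE IHi.
rewrite (big_ord_widen n (fun i => (p`_i *: iter i (fun f => (B \o f)%VF) \1%VF) v)) //.
rewrite big_mkcond /=; apply: eq_bigr => i _; rewrite scale_lfunE iterE.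
by case: ltnP => // /(nth_default 0) ->; rewrite scale0r.
Qed.

Lemma lhornerDZ B a p1 p2 v :
  lhorner B (a *: p1 + p2) v = a *: lhorner B p1 v + lhorner B p2 v.
Proof.
set n := maxn (size (a *: p1 + p2)) (maxn (size p1) (size p2)).
rewrite !(@lhorner_wide _ _ n) ?leq_max ?leqnn ?orbT //.
rewrite scaler_sumr -big_split /=; apply: eq_bigr => i _.
by rewrite coefD coefZ scalerDl scalerA.
Qed.

Lemma lhorner0 B v : lhorner B 0 v = 0.
Proof. by rewrite (@lhorner_wide _ _ 0) ?size_poly0 // big_ord0. Qed.

Lemma lhornerD B p1 p2 v : lhorner B (p1 + p2) v = lhorner B p1 v + lhorner B p2 v.
Proof. by have := lhornerDZ B 1 p1 p2 v; rewrite !scale1r. Qed.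

Lemma lhornerZ B a p v : lhorner B (a *: p) v = a *: lhorner B p v.
Proof. by have := lhornerDZ B a p 0 v; rewrite lhorner0 !addr0. Qed.

Lemma lhornerC B c v : lhorner B c%:P v = c *: v.
Proof. by rewrite (@lhorner_wide _ _ 1) ?size_polyC_leq1 // big_ord1 coefC. Qed.

Lemma lhornerMX B p v : lhorner B (p * 'X) v = B (lhorner B p v).
Proof.
rewrite (@lhorner_wide _ _ (size p).+1) ?(@lhorner_wide _ _ (size p)) //; last first.
  by apply: leq_trans (size_polyMleq _ _) _; rewrite size_polyX addn2.
rewrite big_ord_recl coefMX scale0r add0r linear_sum; apply: eq_bigr => i _.
by rewrite coefMX /= linearZ.
Qed.

Lemma lhornerM B p1 p2 v : lhorner B (p1 * p2) v = lhorner B p1 (lhorner B p2 v).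
Proof.
elim/poly_ind: p1 => [|p c IHp]; first by rewrite mul0r !lhorner0.
by rewrite mulrDl -mulrA ['X * _]mulrC mulrA mul_polyC !lhornerD !lhornerMX
           lhornerZ lhornerC IHp.
Qed.

Lemma lhorner_comm B p1 p2 v :
  lhorner B p1 (lhorner B p2 v) = lhorner B p2 (lhorner B p1 v).
Proof. by rewrite -!lhornerM mulrC. Qed.

Lemma lhorner_sum B (I : Type) (r : seq I) (P : pred I) (p : I -> {poly F}) v :
  lhorner B (\sum_(i <- r | P i) p i) v = \sum_(i <- r | P i) lhorner B (p i) v.
Proof.
elim/big_rec2: _ => [|i y x _ <-]; first exact: lhorner0.
by rewrite lhornerD.
Qed.

Lemma lhorner_XsubC B a v : lhorner B ('X - a%:P) v = B v - a *: v.
Proof.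
rewrite -['X]mul1r -polyCN lhornerD lhornerMX !lhornerC scale1r.
by rewrite scaleNr.
Qed.

Lemma leigenspaceP B a v : reflect (B v = a *: v) (v \in leigenspace B a).
Proof.
rewrite memv_ker add_lfunE opp_lfunE scale_lfunE id_lfunE subr_eq0.
exact: eqP.
Qed.

Lemma lhorner_eigen B a p v :
  v \in leigenspace B a -> lhorner B p v = p.[a] *: v.
Proof.
move=> /leigenspaceP Bv; elim/poly_ind: p => [|p c IHp].
  by rewrite lhorner0 horner0 scale0r.
rewrite lhornerD lhornerMX lhornerC IHp linearZ /= Bv scalerA -scalerDl.
by rewrite !hornerE.
Qed.

Lemma lhorner_linfac B (theta : nat -> F) s v :
  (\big[@comp_lfun F V V V / (\1)%VF]_(j <- s) (B - theta j *: \1%VF))%VF v =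
  lhorner B (\prod_(j <- s) ('X - (theta j)%:P)) v.
Proof.
elim: s v => [|j s IHs] v; first by rewrite !big_nil id_lfunE lhornerC scale1r.
rewrite !big_cons comp_lfunE IHs lhornerM lhorner_XsubC.
by rewrite add_lfunE opp_lfunE scale_lfunE id_lfunE.
Qed.

Lemma split_operatorE A As theta thetas i v :
  split_operator A As theta thetas i v =
  lhorner As (linfac thetas 1 i.+1) (lhorner A (linfac theta 0 i) v).
Proof.
rewrite /split_operator comp_lfunE !lhorner_linfac; congr (lhorner _ _ (lhorner _ _ _)).
by apply: perm_big; rewrite perm_rev /index_iota subn0.
Qed.

End LHorner.

(** * Products of linear factors *)

Section LinFac.
Variables (F : fieldType).
Implicit Types (theta : nat -> F).

Lemma linfac_cat theta m n k : (m <= n)%N -> (n <= k)%N ->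
  linfac theta m k = linfac theta m n * linfac theta n k.
Proof. by move=> mn nk; rewrite /linfac (big_cat_nat mn nk). Qed.

Lemma linfac_nil theta m : linfac theta m m = 1.
Proof. by rewrite /linfac big_geq. Qed.

Lemma linfac_recr theta m n : (m <= n)%N ->
  linfac theta m n.+1 = linfac theta m n * ('X - (theta n)%:P).
Proof. by move=> mn; rewrite /linfac big_nat_recr. Qed.

Lemma linfac_recl theta m n : (m < n)%N ->
  linfac theta m n = ('X - (theta m)%:P) * linfac theta m.+1 n.
Proof. by move=> mn; rewrite /linfac big_ltn. Qed.

Lemma horner_linfac theta m n x :
  (linfac theta m n).[x] = \prod_(m <= j < n) (x - theta j).
Proof. by rewrite horner_prod; apply: eq_bigr => j _; rewrite !hornerE. Qed.

Lemma linfac_monic theta m n : linfac theta m n \is monic.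
Proof. exact: monic_prod_XsubC. Qed.

Lemma size_linfac theta m n : size (linfac theta m n) = (n - m).+1.
Proof. by rewrite size_prod_XsubC size_iota. Qed.

Lemma root_linfac theta m n j : (m <= j < n)%N -> (linfac theta m n).[theta j] = 0.
Proof.
move=> mjn; rewrite horner_linfac (big_rem j) ?mem_index_iota //=.
by rewrite subrr mul0r.
Qed.

End LinFac.
(** * Sums of eigenspaces along a standard ordering *)

Section ESpan.
Variables (F : fieldType) (V : vectType F).
Implicit Types (A B : 'End(V)) (theta : nat -> F) (P Q : pred nat) (d : nat)
  (p : {poly F}) (v : V).

Lemma espanS A theta d P Q :
  (forall j, (j <= d)%N -> P j -> Q j) ->
  (espan A theta d P <= espan A theta d Q)%VS.
Proof.
move=> sPQ; apply/subv_sumP => j Pj.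
by apply: (sumv_sup j) => //; apply: sPQ Pj; rewrite -ltnS.
Qed.

Lemma espan_eq0 A theta d P v :
  v \in espan A theta d P -> (forall j, (j <= d)%N -> ~~ P j) -> v = 0.
Proof.
move=> vP P0; apply/eqP; rewrite -memv0; move: vP; rewrite /espan big_pred0 //.
by move=> j; apply/negbTE/P0; rewrite -ltnS.
Qed.

Lemma leigenspace_espan A theta d P j :
  (j <= d)%N -> P j -> (leigenspace A (theta j) <= espan A theta d P)%VS.
Proof. by rewrite -ltnS => jd Pj; apply: (sumv_sup (Ordinal jd)). Qed.

Lemma espan1 A theta d i : (i <= d)%N ->
  espan A theta d (pred1 i) = leigenspace A (theta i).
Proof.
by rewrite -ltnS => id; rewrite /espan (big_pred1 (Ordinal id)).
Qed.

Lemma espan_min A theta d P i v : (i <= d)%N ->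
  (forall j, (j <= d)%N -> P j -> j = i) ->
  v \in espan A theta d P -> v \in leigenspace A (theta i).
Proof.
move=> id Pi; rewrite -(espan1 A theta id); apply: subvP.
by apply: espanS => j jd /(Pi j jd)/eqP.
Qed.

(** p(A) is a scalar on each eigenspace, and that scalar is zero exactly at the
    roots of p. *)
Lemma lhorner_espan A theta d P p v : v \in espan A theta d P ->
  lhorner A p v \in espan A theta d (fun j => P j && (p.[theta j] != 0)).
Proof.
case/memv_sumP => u uP ->; rewrite linear_sum rpred_sum //= => j Pj.
rewrite (lhorner_eigen _ (uP j Pj)).
have [->|nz] := eqVneq p.[theta j] 0; first by rewrite scale0r mem0v.
apply: rpredZ; apply: subvP (uP j Pj); apply: leigenspace_espan.
  by rewrite -ltnS.
by rewrite Pj.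
Qed.

Lemma espan_step A B theta d P v : standard_ordering A B d theta ->
  v \in espan A theta d P ->
  B v \in espan A theta d
    (fun j => [exists k : 'I_d.+1, [&& P k, (k <= j.+1)%N & (j <= k.+1)%N]]).
Proof.
case=> _ _ step /memv_sumP[u uP ->]; rewrite linear_sum rpred_sum //= => k Pk.
have kd : (k <= d)%N by rewrite -ltnS.
have := subvP (step k kd) _ (memv_img B (uP k Pk)); apply: subvP.
rewrite -/(espan A theta d (fun j => (k <= j.+1)%N && (j <= k.+1)%N)).
apply: espanS => j _ /andP[kj jk].
by apply/existsP; exists k; rewrite Pk kj.
Qed.

Lemma espan_up A B theta d i v : standard_ordering A B d theta ->
  v \in espan A theta d (fun j => (j <= i)%N) ->
  B v \in espan A theta d (fun j => (j <= i.+1)%N).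
Proof.
move=> std /(espan_step std); apply/subvP/espanS => j jd /existsP[k /and3P[ki _ jk]].
exact: leq_trans jk _.
Qed.

Lemma espan_down A B theta d i v : standard_ordering A B d theta ->
  v \in espan A theta d (fun j => (i <= j)%N) ->
  B v \in espan A theta d (fun j => (i.-1 <= j)%N).
Proof.
move=> std /(espan_step std); apply/subvP/espanS => j jd /existsP[k /and3P[ki kj _]].
by rewrite -subn1 leq_subLR add1n; apply: leq_trans kj.
Qed.

Lemma lhorner_espan_up A B theta d i n p v : standard_ordering A B d theta ->
  (size p <= n.+1)%N -> v \in espan A theta d (fun j => (j <= i)%N) ->
  lhorner B p v \in espan A theta d (fun j => (j <= i + n)%N).
Proof.
move=> std sp vi; rewrite (lhorner_wide _ _ sp) rpred_sum // => -[k /= kn] _.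
apply: rpredZ; suff: iter k B v \in espan A theta d (fun j => (j <= i + k)%N).
  apply/subvP/espanS => j _ jk; apply: leq_trans jk _; rewrite leq_add2l //.
elim: k {kn} => [|k IHk]; first by rewrite addn0.
by rewrite iterS addnS; apply: espan_up.
Qed.

Lemma lhorner_espan_down A B theta d i n p v : standard_ordering A B d theta ->
  (size p <= n.+1)%N -> v \in espan A theta d (fun j => (i <= j)%N) ->
  lhorner B p v \in espan A theta d (fun j => (i - n <= j)%N).
Proof.
move=> std sp vi; rewrite (lhorner_wide _ _ sp) rpred_sum // => -[k /= kn] _.
apply: rpredZ; suff: iter k B v \in espan A theta d (fun j => (i - k <= j)%N).
  apply/subvP/espanS => j _ jk; apply: leq_trans jk; rewrite leq_sub2l //.
elim: k {kn} => [|k IHk]; first by rewrite subn0.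
by rewrite iterS subnS; apply: espan_down.
Qed.

Lemma espan_full A B theta d : ldiagonalizable A -> standard_ordering A B d theta ->
  espan A theta d xpredT = fullv.
Proof.
case=> X Xb Xe [_ ev _]; apply/eqP; rewrite eqEsubv subvf /=.
rewrite -(span_basis Xb); apply/span_subvP => v /Xe[a va].
have [->|nzv] := eqVneq v 0; first exact: mem0v.
have /ev[i id ai]: leigenvalue A a.
  by apply: contraNneq nzv => E; rewrite -memv0 -E.
by apply: subvP (va); rewrite -ai; apply: leigenspace_espan.
Qed.

End ESpan.
(** * Split sequences and duality *)

Definition td_system (F : fieldType) (V : vectType F) (A As : 'End(V)) (d : nat)
    (theta thetas : nat -> F) : Prop :=
  [/\ ldiagonalizable A /\ ldiagonalizable As, standard_ordering A As d theta,
      standard_ordering As A d thetas & irreducible_pair A As].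

Lemma td_system_dual (F : fieldType) (V : vectType F) (A As : 'End(V)) d theta thetas :
  td_system A As d theta thetas -> td_system As A d thetas theta.
Proof.
by case=> -[? ?] ? ? irr; split=> // W WAs WA; apply: irr.
Qed.

(** Newton interpolation of e at the nodes theta_0, ..., theta_d.  In the
    induction step the factor x - theta_{d+1} is split as
    (x - theta_0) + (theta_0 - theta_{d+1}). *)
Lemma linfac1_expand (F : fieldType) (theta : nat -> F) d :
  linfac theta 1 d.+1 = \sum_(h < d.+1)
    (\prod_(h.+1 <= j < d.+1) (theta 0%N - theta j)) *: linfac theta 0 h.
Proof.
elim: d => [|d IHd].
  by rewrite linfac_nil big_ord1 linfac_nil big_geq // scale1r.
have E : linfac theta 1 d.+2 = (theta 0%N - theta d.+1) *: linfac theta 1 d.+1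
    + linfac theta 0 d.+1.
  rewrite (@linfac_recr _ _ 1) // (@linfac_recl _ _ 0) // -mul_polyC polyCB; ring.
rewrite E big_ord_recr /= big_geq // scale1r; congr (_ + _).
rewrite {}IHd scaler_sumr; apply: eq_bigr => h _; rewrite scalerA mulrC.
by rewrite [in RHS]big_nat_recr // ltnS ltnW.
Qed.

Section SplitSequence.
Variables (F : fieldType) (V : vectType F).
Implicit Types (A As : 'End(V)) (theta thetas zeta : nat -> F) (d : nat) (v w : V).

Lemma std_diff_neq0 A As d theta m : standard_ordering A As d theta -> (0 < m)%N ->
  \prod_(m <= j < d.+1) (theta 0%N - theta j) != 0.
Proof.
case=> inj _ _ m0; rewrite prodf_seq_neq0; apply/allP => j.
rewrite mem_index_iota ltnS subr_eq0 => /andP[mj jd] /=.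
by apply/eqP => /(inj _ _ (leq0n d) jd) j0; move: (leq_trans m0 mj); rewrite -j0.
Qed.

Lemma std_eigenspace_neq0 A As d theta i : standard_ordering A As d theta -> (i <= d)%N ->
  exists2 v, v \in leigenspace A (theta i) & v != 0.
Proof.
case=> _ ev _ id.
have nz : leigenspace A (theta i) != 0%VS by apply/ev; exists i.
by exists (vpick (leigenspace A (theta i))); rewrite ?memv_pick ?vpick0.
Qed.

Lemma linfac_ladder_As A As d theta thetas i v :
  td_system A As d theta thetas -> v \in leigenspace As (thetas 0%N) ->
  lhorner A (linfac theta 0 i) v \in espan As thetas d (fun j => (j <= i)%N).
Proof.
case=> _ _ stds _ v0.
have v0' : v \in espan As thetas d (fun j => (j <= 0)%N).
  by apply: (subvP _ _ v0); apply: leigenspace_espan.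
by apply: (lhorner_espan_up stds _ v0'); rewrite size_linfac subn0.
Qed.

Lemma linfac_ladder_A A As d theta thetas i v :
  td_system A As d theta thetas ->
  lhorner A (linfac theta 0 i) v \in espan A theta d (fun j => (i <= j)%N).
Proof.
case=> -[diagA _] std _ _.
have vV : v \in espan A theta d xpredT by rewrite (espan_full diagA std) memvf.
apply: subvP (lhorner_espan (linfac theta 0 i) vV); apply: espanS => j _ /=.
by rewrite leqNgt; apply: contra => ji; rewrite root_linfac.
Qed.

Lemma linfac1_kill A theta d v : v \in espan A theta d (fun j => (0 < j)%N) ->
  lhorner A (linfac theta 1 d.+1) v = 0.
Proof.
move=> v1; apply: (espan_eq0 (lhorner_espan (linfac theta 1 d.+1) v1)) => j jd.
by apply/negP => /andP[j0]; rewrite root_linfac ?eqxx // j0 ltnS.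
Qed.

Lemma split_operator_stable A As d theta thetas i v :
  td_system A As d theta thetas -> v \in leigenspace As (thetas 0%N) ->
  split_operator A As theta thetas i v \in leigenspace As (thetas 0%N).
Proof.
move=> td /(linfac_ladder_As i td)/(lhorner_espan (linfac thetas 1 i.+1)).
rewrite -split_operatorE; apply: espan_min => // j jd /andP[ji].
by case: j jd ji => // j jd ji; rewrite root_linfac ?eqxx.
Qed.

(** The split operator sends V*_0 to itself, so the factors of e* beyond the i-th
    act on its values by explicit scalars.  The left-hand side involves the
    ordering theta only through tau_i, and is linear in tau_i. *)
Lemma compressE A As d theta thetas i v : (i <= d)%N ->
  td_system A As d theta thetas -> v \in leigenspace As (thetas 0%N) ->
  lhorner As (linfac thetas 1 d.+1) (lhorner A (linfac theta 0 i) v) =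
  \prod_(i.+1 <= j < d.+1) (thetas 0%N - thetas j)
    *: split_operator A As theta thetas i v.
Proof.
move=> id td v0; rewrite (@linfac_cat _ thetas 1 i.+1) // lhornerM lhorner_comm.
rewrite -split_operatorE.
by rewrite (lhorner_eigen _ (split_operator_stable i td v0)) horner_linfac.
Qed.

Lemma compress_split A As d theta thetas zeta :
  td_system A As d theta thetas ->
  (forall i v, (i <= d)%N -> v \in leigenspace As (thetas 0%N) ->
    lhorner As (linfac thetas 1 d.+1) (lhorner A (linfac theta 0 i) v) =
    (\prod_(i.+1 <= j < d.+1) (thetas 0%N - thetas j) * zeta i) *: v) ->
  split_sequence A As d theta thetas zeta.
Proof.
move=> td H i id v v0; have := H i v id v0; rewrite (compressE id td v0) -scalerA.
case: td => _ _ stds _; apply: scalerI; exact: std_diff_neq0 stds _.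
Qed.

Lemma split_uniq A As d theta thetas zeta zeta' i : 
  standard_ordering As A d thetas ->
  split_sequence A As d theta thetas zeta ->
  split_sequence A As d theta thetas zeta' -> (i <= d)%N -> zeta i = zeta' i.
Proof.
move=> stds sp sp' id; have [v v0 nz] := std_eigenspace_neq0 stds (leq0n d).
apply/eqP; rewrite -subr_eq0; have /eqP := sp i id v v0.
by rewrite (sp' i id v v0) -subr_eq0 -scalerBl scaler_eq0 (negbTE nz) orbF
   -opprB oppr_eq0.
Qed.

(** The components U_i of the split decomposition are raised by A - theta_i and
    lowered by As - theta*_i, so their sum is invariant, hence equal to V by
    irreducibility.  Only U_0 escapes V_1 + ... + V_d, and U_0 lies in V*_0. *)
Lemma eigenspace0_plus_tail A As d theta thetas :
  td_system A As d theta thetas ->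
  (leigenspace As (thetas 0%N) + espan A theta d (fun j => (0 < j)%N))%VS = fullv.
Proof.
move=> td; have [_ std stds irr] := td.
pose U i := (espan As thetas d (fun j => (j <= i)%N)
             :&: espan A theta d (fun j => (i <= j)%N))%VS.
pose W := (\sum_(i < d.+1) U i)%VS.
have UW i : (i <= d)%N -> (U i <= W)%VS.
  by rewrite -ltnS => id; apply: (sumv_sup (Ordinal id)).
have WA : (A @: W <= W)%VS.
  rewrite limg_sum; apply/subv_sumP => i _; apply/subvP => _ /memv_imgP[u uU ->].
  have id : (i <= d)%N by rewrite -ltnS.
  rewrite -[A u](subrK (theta i *: u)); apply: rpredD; last first.
    by apply: rpredZ; apply: subvP uU; apply: UW.
  move: uU; rewrite /U memv_cap => /andP[u1 u2].
  have w2 : A u - theta i *: u \in espan A theta d (fun j => (i < j)%N).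
    rewrite -lhorner_XsubC; apply: subvP (lhorner_espan ('X - (theta i)%:P) u2).
    apply: espanS => j _ /andP[ij]; rewrite !hornerE subr_eq0 ltn_neqAle ij andbT.
    by apply: contraNneq => ->.
  have w1 : A u - theta i *: u \in espan As thetas d (fun j => (j <= i.+1)%N).
    rewrite rpredB //; first exact: (espan_up stds).
    apply: rpredZ; apply: subvP u1; apply: espanS => j _ ji; exact: leqW.
  case: (ltnP i d) => [lt_id|le_di].
    by apply: (subvP (UW i.+1 lt_id)); rewrite memv_cap w1.
  rewrite (espan_eq0 w2) ?mem0v // => j jd.
  by rewrite -leqNgt (leq_trans jd).
have WAs : (As @: W <= W)%VS.
  rewrite limg_sum; apply/subv_sumP => i _; apply/subvP => _ /memv_imgP[u uU ->].
  have id : (i <= d)%N by rewrite -ltnS.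
  rewrite -[As u](subrK (thetas i *: u)); apply: rpredD; last first.
    by apply: rpredZ; apply: subvP uU; apply: UW.
  move: uU; rewrite /U memv_cap => /andP[u1 u2].
  have w1 : As u - thetas i *: u \in espan As thetas d (fun j => (j < i)%N).
    rewrite -lhorner_XsubC; apply: subvP (lhorner_espan ('X - (thetas i)%:P) u1).
    apply: espanS => j _ /andP[ij]; rewrite !hornerE subr_eq0 ltn_neqAle ij andbT.
    by apply: contraNneq => ->.
  have w2 : As u - thetas i *: u \in espan A theta d (fun j => (i.-1 <= j)%N).
    rewrite rpredB //; first exact: (espan_down std).
    apply: rpredZ; apply: subvP u2; apply: espanS => j _; apply: leq_trans.
    exact: leq_pred.
  case: (posnP i) => [i0|i0].
    by rewrite (espan_eq0 w1) ?mem0v // => j jd; rewrite i0.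
  apply: (subvP (UW i.-1 (leq_trans (leq_pred i) id))); rewrite memv_cap w2 andbT.
  by apply: subvP w1; apply: espanS => j _; rewrite -{1}(prednK i0).
have Wfull : W = fullv.
  have [W0|//] := irr W WA WAs.
  have [v v0 nz] := std_eigenspace_neq0 stds (leq0n d).
  case/negP: nz; rewrite -memv0 -W0; apply: (subvP (UW 0%N (leq0n d))).
  rewrite memv_cap; apply/andP; split.
    by apply: (subvP _ _ v0); apply: leigenspace_espan.
  by have := linfac_ladder_A 0%N v td; rewrite linfac_nil lhornerC scale1r.
apply/eqP; rewrite eqEsubv subvf -Wfull; apply/subv_sumP => -[[|i] /= id] _.
  apply: subv_trans (addvSl _ _); apply/subvP => u; rewrite memv_cap => /andP[u1 _].
  by apply: espan_min u1 => // j _; rewrite leqn0 => /eqP.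
apply: subv_trans (addvSr _ _); apply: subv_trans (capvSr _ _) _.
by apply: espanS => j _; apply: leq_trans.
Qed.

(** V_0 is the image of V*_0 under the projection along V_1 + ... + V_d. *)
Lemma eigenspace0_onto A As d theta thetas w :
  td_system A As d theta thetas -> w \in leigenspace A (theta 0%N) ->
  exists2 v, v \in leigenspace As (thetas 0%N)
           & w = lhorner A (linfac theta 1 d.+1) v.
Proof.
move=> td w0; have [_ std _ _] := td.
pose c := \prod_(1 <= j < d.+1) (theta 0%N - theta j).
have nzc : c != 0 by exact: std_diff_neq0 std _.
have : c^-1 *: w \in fullv by rewrite memvf.
rewrite -(eigenspace0_plus_tail td) => /memv_addP[v v0 [u u1 wvu]]; exists v => //.
have -> : v = c^-1 *: w - u by rewrite wvu addrK.
rewrite linearB linearZ /= (linfac1_kill u1) subr0 (lhorner_eigen _ w0).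
by rewrite horner_linfac -/c scalerA mulVf // scale1r.
Qed.

(** For h < i, tau_h(A) v lies in V*_0 + ... + V*_h, which tau*_i(As) kills.  For
    h > i, it lies in V_h + ... + V_d, which As applied at most i times keeps
    inside V_1 + ... + V_d, killed by e(A).  For h = i, tau*_i may be replaced by
    the polynomial of the split operator, since both are monic of degree i and the
    difference has lower degree. *)
Lemma split_kronecker A As d theta thetas zeta i h v :
  td_system A As d theta thetas -> split_sequence A As d theta thetas zeta ->
  (i <= d)%N -> v \in leigenspace As (thetas 0%N) ->
  lhorner A (linfac theta 1 d.+1)
    (lhorner As (linfac thetas 0 i) (lhorner A (linfac theta 0 h) v)) =
  (if h == i then zeta i else 0) *: lhorner A (linfac theta 1 d.+1) v.
Proof.
move=> td sp id v0; have [_ std stds _] := td.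
have low n (p : {poly F}) : (size p <= n.+1)%N -> (n < h)%N -> lhorner A (linfac theta 1 d.+1)
    (lhorner As p (lhorner A (linfac theta 0 h) v)) = 0.
  move=> sp_n nh; apply: linfac1_kill.
  apply: subvP (lhorner_espan_down std sp_n (linfac_ladder_A h v td)).
  by apply: espanS => j _; apply: leq_trans; rewrite subn_gt0.
case: (ltngtP h i) => [hi|ih|hi].
- rewrite scale0r (espan_eq0 (lhorner_espan _ (linfac_ladder_As h td v0))) ?linear0 //.
  move=> j jd; apply/negP => /andP[jh]; rewrite root_linfac ?eqxx //.
  exact: leq_ltn_trans jh hi.
- by rewrite scale0r (low i) // size_linfac subn0.
rewrite {}hi in low *; have := sp i id v v0; rewrite split_operatorE.
case: i id low => [|i] id low; first by rewrite !linfac_nil => ->; rewrite linearZ.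
move=> E.
have -> : linfac thetas 0 i.+1 = linfac thetas 1 i.+2
    + (thetas i.+1 - thetas 0%N) *: linfac thetas 1 i.+1.
  rewrite (@linfac_recr _ _ 1) // (@linfac_recl _ _ 0) // -mul_polyC polyCB; ring.
rewrite lhornerD linearD /= E linearZ /= lhornerZ linearZ /= (low i) //.
  by rewrite scaler0 addr0.
by rewrite size_linfac subn1.
Qed.

(** On w = e(A) v with v in V*_0, expanding e in the Newton basis leaves a single
    term of e(A) tau*_i(As) w, namely that of index i; every w in V_0 has this
    form. *)
Lemma split_dual A As d theta thetas zeta :
  td_system A As d theta thetas -> split_sequence A As d theta thetas zeta ->
  split_sequence As A d thetas theta zeta.
Proof.
move=> td sp; apply: (compress_split (td_system_dual td)) => i w id w0.
have [v v0 ->] := eigenspace0_onto td w0.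
rewrite [X in lhorner As _ (lhorner A X v)]linfac1_expand lhorner_sum !linear_sum /=.
have iD : (i < d.+1)%N by [].
rewrite (bigD1 (Ordinal iD)) //= [X in _ + X]big1 ?addr0 => [|h hi]; last first.
  rewrite lhornerZ !linearZ /= (split_kronecker _ td sp) // -val_eqE /= in hi *.
  by rewrite (negbTE hi) scale0r scaler0.
by rewrite lhornerZ !linearZ /= (split_kronecker _ td sp) // eqxx scalerA.
Qed.

End SplitSequence.
(** * The identity behind the reversal of an ordering *)

Section Identity.
Variable R : comRingType.
Implicit Types (y c Q l : R).

Definition qcoef c Q n k := \prod_(0 <= j < k) (c * (Q ^+ (n - j) - 1)).
Definition qshift Q l k := \prod_(0 <= j < k) (Q ^+ j - l).
Definition qtail y c Q m n := \prod_(m <= h < n) (y - c * Q ^+ h).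

(** Once the factor l in front of the second sum is absorbed by
    l S_k = Q^k S_k - S_{k+1}, where S_k = qshift Q l k, the difference of the two
    sums telescopes. *)
Lemma reversed_rec y c Q l d :
  \sum_(k < d.+2) qcoef c Q d.+1 k * qshift Q l k * qtail y c Q k.+1 d.+2 =
  qtail y c Q 0 d.+1 + c * l * (1 - Q ^+ d.+1) *
    \sum_(k < d.+1) qcoef c Q d k * qshift Q l k * qtail y c Q k.+1 d.+1.
Proof.
pose G k := qcoef c Q d.+1 k * qshift Q l k * qtail y c Q k d.+1.
have -> : qtail y c Q 0 d.+1 = G 0.
  by rewrite /G /qcoef /qshift !big_geq // !mul1r.
have Gd : qcoef c Q d.+1 d.+1 * qshift Q l d.+1 * qtail y c Q d.+2 d.+2 = G d.+1.
  by rewrite /G /qtail !big_geq.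
rewrite big_ord_recr /= Gd.
suff: \sum_(k < d.+1) (G k.+1 - G k) = - \sum_(k < d.+1)
   (qcoef c Q d.+1 k * qshift Q l k * qtail y c Q k.+1 d.+2
    - c * l * (1 - Q ^+ d.+1) * (qcoef c Q d k * qshift Q l k * qtail y c Q k.+1 d.+1)).
  rewrite -(big_mkord xpredT (fun k => G k.+1 - G k)) telescope_sumr // sumrB -mulr_sumr.
  by move/eqP; rewrite subr_eq => /eqP ->; ring.
rewrite -sumrN; apply: eq_bigr => -[k /= kd] _; rewrite ltnS in kd.
have C1 : qcoef c Q d.+1 k.+1 = qcoef c Q d.+1 k * (c * (Q ^+ (d.+1 - k) - 1)).
  by rewrite /qcoef big_nat_recr.
have C2 : qcoef c Q d.+1 k.+1 = c * (Q ^+ d.+1 - 1) * qcoef c Q d k.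
  by rewrite /qcoef big_nat_recl // subn0.
have S1 : qshift Q l k.+1 = qshift Q l k * (Q ^+ k - l).
  by rewrite /qshift big_nat_recr.
have T1 : qtail y c Q k d.+1 = (y - c * Q ^+ k) * qtail y c Q k.+1 d.+1.
  by rewrite /qtail big_ltn.
have T2 : qtail y c Q k.+1 d.+2 = qtail y c Q k.+1 d.+1 * (y - c * Q ^+ d.+1).
  by rewrite /qtail big_nat_recr.
have QQ : Q ^+ d.+1 = Q ^+ (d.+1 - k) * Q ^+ k by rewrite -exprD subnK // leqW.
have C3 : c * l * (1 - Q ^+ d.+1) * (qcoef c Q d k * qshift Q l k * qtail y c Q k.+1 d.+1)
  = - (qcoef c Q d.+1 k.+1 * l * qshift Q l k * qtail y c Q k.+1 d.+1).
  by rewrite C2; ring.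
rewrite C3 /G T2 T1 S1 C1 QQ; ring.
Qed.

(** A two-variable form of the q-Chu-Vandermonde summation.  The left-hand side
    F_d visibly satisfies F_{d+1} = tau_{d+1} + l c (1 - Q^{d+1}) F_d, and
    [reversed_rec] is the same recursion for the right-hand side, read in
    reverse order. *)
Lemma reversal_identity y c Q l d :
  \sum_(i < d.+1) (\prod_(0 <= h < i) (y - c * Q ^+ h)) *
     \prod_(i.+1 <= j < d.+1) (l * (c * (1 - Q ^+ j))) =
  \sum_(i < d.+1) (\prod_(0 <= h < i) (y - c * Q ^+ (d - h))) *
     \prod_(i.+1 <= j < d.+1) (c * (Q ^+ j - 1) * (Q ^+ (d - j) - l)).
Proof.
transitivity (\sum_(k < d.+1) qcoef c Q d k * qshift Q l k * qtail y c Q k.+1 d.+1).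
  elim: d => [|d IHd].
    by rewrite !big_ord1 /qcoef /qshift /qtail !big_geq // !mulr1.
  rewrite reversed_rec -{}IHd big_ord_recr /= [X in _ * X]big_geq // mulr1 addrC.
  congr (_ + _); rewrite mulr_sumr; apply: eq_bigr => i _.
  by rewrite [X in _ * X = _]big_nat_recr ?ltn_ord //=; ring.
rewrite [RHS](reindex_inj rev_ord_inj) /=; apply: eq_bigr => -[k /= kd] _.
rewrite ltnS in kd; rewrite subSS.
rewrite mulrC; congr (_ * _).
  rewrite /qtail -[k.+1]add0n big_addn big_nat_rev add0n subSS big_nat [RHS]big_nat.
  apply: eq_bigr => h /andP[_ hk]; congr (_ - _ * _ ^+ _).
  by rewrite subnS -subSKn; lia.
rewrite /qcoef /qshift -big_split /= big_nat_rev add0n.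
rewrite -[(d - k).+1 in RHS]add0n big_addn.
have -> : (d.+1 - (d - k).+1 = k)%N by lia.
rewrite big_nat [RHS]big_nat; apply: eq_bigr => j /andP[_ jk].
by congr (_ * (_ ^+ _ - _) * (_ ^+ _ - _)); lia.
Qed.

End Identity.
(** * Reversing one ordering *)

Section Reordering.
Variables (F : fieldType) (V : vectType F).
Implicit Types (A As : 'End(V)) (theta thetas zeta u : nat -> F) (d : nat)
  (v : V) (f : {poly F}).

(** The Newton polynomials tau_0, ..., tau_d span the polynomials of degree at most
    d, so the scalar action on V*_0 extends from them to all such polynomials. *)
Lemma compress_scalar A As d theta thetas zeta n f :
  td_system A As d theta thetas -> split_sequence A As d theta thetas zeta ->
  (n <= d.+1)%N -> (size f <= n)%N ->
  exists c, forall v, v \in leigenspace As (thetas 0%N) ->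
    lhorner As (linfac thetas 1 d.+1) (lhorner A f v) = c *: v.
Proof.
move=> td sp; elim: n f => [|n IHn] f nd.
  rewrite leqn0 size_poly_eq0 => /eqP->; exists 0 => v _.
  by rewrite lhorner0 linear0 scale0r.
move=> sf; pose t := linfac theta 0 n.
have tn : t`_n = 1.
  have /monicP := linfac_monic theta 0%N n.
  by rewrite /lead_coef size_linfac subn0.
have [||c Hc] := IHn (f - f`_n *: t); first exact: ltnW.
  apply/leq_sizeP => j; rewrite leq_eqVlt => /predU1P[<-|nj].
    by rewrite coefB coefZ tn mulr1 subrr.
  have st : (size t <= n.+1)%N by rewrite size_linfac subn0.
  by rewrite coefB coefZ (leq_sizeP _ _ sf j nj) (leq_sizeP _ _ st j nj) mulr0 subr0.
exists (c + f`_n * (\prod_(n.+1 <= j < d.+1) (thetas 0%N - thetas j) * zeta n)).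
move=> v v0; rewrite -[f in LHS](subrK (f`_n *: t)) lhornerD linearD /= Hc //.
by rewrite lhornerZ linearZ /= (compressE _ td) // sp // !scalerA -scalerDl mulrA.
Qed.

Lemma split_reorder_exists A As d theta theta' thetas zeta :
  td_system A As d theta thetas -> td_system A As d theta' thetas ->
  split_sequence A As d theta thetas zeta ->
  exists zeta', split_sequence A As d theta' thetas zeta'.
Proof.
move=> td td' sp; have [_ _ stds _] := td.
have : forall i : 'I_d.+1, exists c, forall v, v \in leigenspace As (thetas 0%N) ->
    lhorner As (linfac thetas 1 d.+1) (lhorner A (linfac theta' 0 i) v) = c *: v.
  by move=> i; apply: (compress_scalar td sp (leqnn _)); rewrite size_linfac subn0.
case/fin_all_exists => c Hc.
exists (fun i => (\prod_(i.+1 <= j < d.+1) (thetas 0%N - thetas j))^-1 * c (inord i)).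
apply: (compress_split td') => i v id v0; have := Hc (inord i) v v0.
by rewrite inordK // => ->; rewrite mulVKf // (std_diff_neq0 stds).
Qed.

(** A weighted sum of the zeta_i is the value of one linear functional at the
    corresponding sum of Newton polynomials; this transports polynomial identities
    to identities between split sequences. *)
Lemma split_weighted_sum A As d theta theta' thetas zeta zeta' u u' :
  td_system A As d theta thetas -> td_system A As d theta' thetas ->
  split_sequence A As d theta thetas zeta ->
  split_sequence A As d theta' thetas zeta' ->
  \sum_(i < d.+1) (\prod_(i.+1 <= j < d.+1) u j) *: linfac theta 0 i =
  \sum_(i < d.+1) (\prod_(i.+1 <= j < d.+1) u' j) *: linfac theta' 0 i ->
  \sum_(i < d.+1)
     (\prod_(i.+1 <= j < d.+1) (u j * (thetas 0%N - thetas j))) * zeta i =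
  \sum_(i < d.+1)
     (\prod_(i.+1 <= j < d.+1) (u' j * (thetas 0%N - thetas j))) * zeta' i.
Proof.
move=> td td' sp sp' eq_uu'; have [_ _ stds _] := td.
have [v v0 nz] := std_eigenspace_neq0 stds (leq0n d).
have sumE th z w : td_system A As d th thetas -> split_sequence A As d th thetas z ->
    lhorner As (linfac thetas 1 d.+1) (lhorner A
      (\sum_(i < d.+1) (\prod_(i.+1 <= j < d.+1) w j) *: linfac th 0 i) v) =
    (\sum_(i < d.+1)
      (\prod_(i.+1 <= j < d.+1) (w j * (thetas 0%N - thetas j))) * z i) *: v.
  move=> tdh sph; rewrite lhorner_sum linear_sum scaler_suml /=.
  apply: eq_bigr => i _; have id : (i <= d)%N by rewrite -ltnS.
  by rewrite lhornerZ linearZ /= (compressE id tdh) // sph // !scalerA big_split.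
apply/eqP; rewrite -subr_eq0; have := sumE _ _ u td sp.
rewrite eq_uu' (sumE _ _ u' td' sp') => /eqP.
rewrite -subr_eq0 -scalerBl scaler_eq0 (negbTE nz) orbF.
by rewrite -opprB oppr_eq0.
Qed.

End Reordering.

Definition qord (F : fieldType) (s : F) (d i : nat) : F :=
  s ^ ((2 * i)%N%:Z - d%:Z).

Lemma qordE (F : fieldType) (s : F) d i : s != 0 ->
  qord s d i = s^-1 ^+ d * (s ^+ 2) ^+ i.
Proof.
by move=> s0; rewrite /qord expfzDr // exprVn -exprM mulrC -invr_expz.
Qed.

(** The normalized Drinfeld polynomial, where mu_j stands for
    b b* q^{2j-2d} + c c* q^{2d-2j}. *)
Definition Drinfeld_sum (F : fieldType) (s : F) (d : nat) (mu zeta : nat -> F) :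
    {poly F} :=
  \sum_(i < d.+1) (zeta i)%:P *
    \prod_(i.+1 <= j < d.+1) (((s ^+ j - s ^- j) ^+ 2)%:P * ((mu j)%:P - 'X)).

Lemma poly_ext (F : closedFieldType) (f g : {poly F}) :
  (forall x, f.[x] = g.[x]) -> f = g.
Proof.
move=> eq_fg; apply/eqP; rewrite -subr_eq0; apply/negPn/negP.
by case/closed_nonrootP => x; rewrite /root hornerD hornerN eq_fg subrr eqxx.
Qed.

(** Both sides are compared at each value l of the variable.  The weights fed to
    [split_weighted_sum] are the factors of the Drinfeld polynomial divided by
    theta*_0 - theta*_j, and [reversal_identity] with Q = s^-2 and c = s^d says
    that the two weighted sums of Newton polynomials agree. *)
Lemma Drinfeld_sum_reverse (F : closedFieldType) (V : vectType F) (A As : 'End(V))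
    (s : F) d zeta zeta' : s != 0 ->
  td_system A As d (qord s^-1 d) (qord s d) -> td_system A As d (qord s d) (qord s d) ->
  split_sequence A As d (qord s^-1 d) (qord s d) zeta ->
  split_sequence A As d (qord s d) (qord s d) zeta' ->
  Drinfeld_sum s d (fun=> 0) zeta =
  Drinfeld_sum s d (fun j => (s^-1 ^+ 2) ^+ (d - j)) zeta'.
Proof.
move=> s0 td td' sp sp'; apply: poly_ext => l.
have [c defc] : exists c, c = s ^+ d by exists (s ^+ d).
have [Q defQ] : exists Q, Q = s^-1 ^+ 2 by exists (s^-1 ^+ 2).
have c0 : c != 0 by rewrite defc expf_neq0.
have sE mu z : (Drinfeld_sum s d mu z).[l] = \sum_(i < d.+1)
    (\prod_(i.+1 <= j < d.+1) ((s ^+ j - s ^- j) ^+ 2 * (mu j - l))) * z i.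
  rewrite horner_sum; apply: eq_bigr => i _.
  rewrite hornerM hornerC horner_prod mulrC; congr (_ * _).
  by apply: eq_bigr => j _; rewrite !hornerE.
have diffE j : qord s d 0 - qord s d j = c^-1 * (1 - (s ^+ j) ^+ 2).
  by rewrite !qordE // expr0 exprVn -defc -!exprM mulnC; ring.
have QE j : Q ^+ j = ((s ^+ j) ^+ 2)^-1 by rewrite defQ -!exprM mulnC !exprVn exprM.
rewrite !sE -defQ.
have := @split_weighted_sum _ V A As d _ _ _ _ _ (fun j => l * (c * (1 - Q ^+ j)))
  (fun j => c * (Q ^+ j - 1) * (Q ^+ (d - j) - l)) td td' sp sp'.
move=> H; transitivity (\sum_(i < d.+1) (\prod_(i.+1 <= j < d.+1)
   (l * (c * (1 - Q ^+ j)) * (qord s d 0 - qord s d j))) * zeta i).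
  apply: eq_bigr => i _; congr (_ * _); apply: eq_bigr => j _; rewrite diffE QE.
  by have := expf_neq0 j s0; move: (s ^+ j) => x x0; field; rewrite x0 c0.
rewrite {}H; last first.
  have liftE th w : \sum_(i < d.+1) (\prod_(i.+1 <= j < d.+1) w j) *: linfac th 0 i =
      \sum_(i < d.+1) (\prod_(0 <= h < i) ('X - (th h)%:P))
        * \prod_(i.+1 <= j < d.+1) (w j)%:P :> {poly F}.
    by apply: eq_bigr => i _; rewrite mulrC -mul_polyC rmorph_prod.
  rewrite !liftE; have H := reversal_identity 'X c%:P Q%:P l%:P d.
  etransitivity; last (etransitivity; first exact: H).
    apply: eq_bigr => i _; congr (_ * _); apply: eq_bigr => h _.
      by rewrite qordE ?invr_eq0 // invrK -defc -defQ polyCM (polyC_exp _ Q).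
    by rewrite !polyCM polyCB polyC1 (polyC_exp _ Q).
  apply: eq_bigr => i _; congr (_ * _).
    rewrite big_nat [RHS]big_nat; apply: eq_bigr => h /andP[_ hi].
    have hd : (h <= d)%N by rewrite ltnW // (leq_trans hi) // -ltnS.
    rewrite -(polyC_exp _ Q) -polyCM qordE //; congr ('X - _%:P).
    rewrite QE defc -!exprM mulnBl exprB ?unitfE ?leq_mul //.
    by rewrite exprM (mulnC h) exprVn; field; rewrite !expf_neq0.
  by apply: eq_bigr => j _; rewrite !polyCM !polyCB polyC1 !(polyC_exp _ Q).
apply: eq_bigr => i _; congr (_ * _); apply: eq_bigr => j _; rewrite diffE (QE j).
by have := expf_neq0 j s0; move: (s ^+ j) => x x0; field; rewrite x0 c0.
Qed.
(** * Uniqueness of standard orderings up to reversal *)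

(** An injective walk with steps of length 1 never turns back, and d steps inside
    {0, ..., d} must then start at an end. *)
Lemma unit_steps_monotone d (p : nat -> nat) :
  (forall i, (i <= d)%N -> (p i <= d)%N) ->
  (forall i j, (i <= d)%N -> (j <= d)%N -> p i = p j -> i = j) ->
  (forall i, (i < d)%N -> p i = (p i.+1).+1 \/ p i.+1 = (p i).+1) ->
  (forall i, (i <= d)%N -> p i = i) \/ (forall i, (i <= d)%N -> p i = (d - i)%N).
Proof.
move=> ub inj step; case: d ub inj step => [|d] ub inj step.
  by left=> i id; have := ub i id; lia.
case: (step 0%N isT) => p1; [right|left] => i id.
  have desc k : (k <= d)%N -> ((p k.+1).+1 = p k)%N.
    elim: k => [|k IHk] kd; first by rewrite p1.
    have Ek := IHk (ltnW kd); have [//|pk] := step k.+1 kd.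
    by have E : k = k.+2; [apply: inj | ]; lia.
  have sumE k : (k <= d.+1)%N -> (p k + k = p 0)%N.
    by elim: k => [|k IHk] kd; [rewrite addn0 | have := desc k kd; have := IHk (ltnW kd); lia].
  by have := sumE i id; have := sumE d.+1 (leqnn _); have := ub 0%N isT; lia.
have asc k : (k <= d)%N -> (p k.+1 = (p k).+1)%N.
  elim: k => [|k IHk] kd; first by rewrite p1.
  have Ek := IHk (ltnW kd); have [pk|//] := step k.+1 kd.
  by have E : k = k.+2; [apply: inj | ]; lia.
have sumE k : (k <= d.+1)%N -> (p k = p 0 + k)%N.
  by elim: k => [|k IHk] kd; [rewrite addn0 | have := asc k kd; have := IHk (ltnW kd); lia].
by have := sumE i id; have := sumE d.+1 (leqnn _); have := ub d.+1 (leqnn _); lia.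
Qed.

Section StandardOrderings.
Variables (F : fieldType) (V : vectType F).
Implicit Types (A As B : 'End(V)) (theta thetas zeta : nat -> F) (d : nat) (v : V).

Lemma standard_ordering_eq A B d theta theta' :
  (forall i, (i <= d)%N -> theta i = theta' i) ->
  standard_ordering A B d theta -> standard_ordering A B d theta'.
Proof.
move=> eqt [inj ev step]; split.
- by move=> i j id jd; rewrite -!eqt //; apply: inj.
- move=> x; rewrite ev; split=> -[i id E]; exists i => //; rewrite -E.
    by rewrite eqt.
  by rewrite eqt.
move=> i id; rewrite -eqt //; apply: subv_trans (step i id) _.
apply/subv_sumP => j Pj; apply: (sumv_sup j) => //; rewrite eqt //.
by rewrite -ltnS.
Qed.

Lemma standard_ordering_rev A B d theta :
  standard_ordering A B d theta ->
  standard_ordering A B d (fun i => theta (d - i)%N).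
Proof.
move=> [inj ev step]; split.
- by move=> i j id jd /inj; rewrite !leq_subr => /(_ isT isT); lia.
- move=> x; rewrite ev; split=> -[i id E]; exists (d - i)%N; rewrite ?leq_subr //.
  by rewrite subKn.
move=> i id; apply: subv_trans (step _ (leq_subr i d)) _.
apply/subv_sumP => j /andP[ij ji]; have jd : (j <= d)%N by rewrite -ltnS.
apply: (sumv_sup (rev_ord j)); rewrite /= subSS; last by rewrite subKn.
by apply/andP; split; lia.
Qed.

Lemma split_sequence_eq A As d theta theta' thetas thetas' zeta :
  (forall i, (i <= d)%N -> theta i = theta' i) ->
  (forall i, (i <= d)%N -> thetas i = thetas' i) ->
  split_sequence A As d theta thetas zeta ->
  split_sequence A As d theta' thetas' zeta.
Proof.
move=> eqt eqts sp i id v; rewrite -eqts // => v0; rewrite -(sp i id v v0).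
rewrite !split_operatorE /linfac; congr (lhorner _ _ (lhorner _ _ _)).
  apply: eq_big_nat => j /andP[_ ji]; rewrite eqts // -ltnS.
  exact: leq_trans ji _.
apply: eq_big_nat => j /andP[_ ji]; rewrite eqt //; apply: ltnW.
exact: leq_trans ji _.
Qed.

(** If theta_i and theta_{i+1} were not adjacent in the ordering theta', then As
    would map V_{theta_i} into eigenspaces near theta_i in both orderings, hence
    without component at theta_{i+1}; so V_{theta_0} + ... + V_{theta_i} would be
    invariant under both maps. *)
Lemma standard_ordering_adjacent A B d theta theta' i a b :
  ldiagonalizable A -> irreducible_pair A B ->
  standard_ordering A B d theta -> standard_ordering A B d theta' ->
  (i < d)%N -> (a <= d)%N -> (b <= d)%N ->
  theta i = theta' a -> theta i.+1 = theta' b -> a = b.+1 \/ b = a.+1.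
Proof.
move=> diagA irr std std' id ad bd Ea Eb.
have [inj ev step] := std; have [inj' ev' _] := std'.
case: (boolP ((a == b.+1) || (b == a.+1))) => [/orP[]/eqP|]; [by left|by right|].
rewrite negb_or => /andP[nab nba]; exfalso.
have nEab : a != b.
  apply/eqP => E; have : theta i = theta i.+1 by rewrite Ea Eb E.
  by move/inj => /(_ (ltnW id) id); lia.
pose W := espan A theta d (fun j => (j <= i)%N).
have WA : (A @: W <= W)%VS.
  apply/subvP => _ /memv_imgP[u uW ->].
  have -> : A u = lhorner A 'X u by rewrite -['X]mul1r lhornerMX lhornerC scale1r.
  by apply: subvP (lhorner_espan 'X uW); apply: espanS => j _ /andP[].
(* P(A) is, up to a nonzero scalar, the projection onto the eigenspace of
   theta_{i+1}. *)
pose P := linfac theta 0 i.+1 * linfac theta i.+2 d.+1.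
have P0 j : (j <= d)%N -> j != i.+1 -> P.[theta j] = 0.
  move=> jd ji; rewrite /P hornerM; case: (ltngtP j i.+1) ji => // ji _.
    by rewrite root_linfac ?mul0r.
  by rewrite (@root_linfac _ _ i.+2) ?mulr0 // ji.
have Pb : P.[theta i.+1] != 0.
  rewrite /P hornerM !horner_linfac mulf_neq0 // prodf_seq_neq0; apply/allP => j;
  rewrite mem_index_iota subr_eq0 => /andP[j1 j2]; apply/eqP => /inj E.
    by have := E id (leq_trans (ltnW j2) id); lia.
  by have := E id j2; lia.
have WB : (B @: W <= W)%VS.
  rewrite limg_sum; apply/subv_sumP => j ji.
  have jd : (j <= d)%N by rewrite -ltnS.
  have near : (B @: leigenspace A (theta j) <=
      espan A theta d (fun k => (j <= k.+1)%N && (k <= j.+1)%N))%VS := step j jd.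
  case: (ltngtP j i) ji => // [lt_ji _ | eq_ji _].
    apply: subv_trans near _; apply: espanS => k _ /andP[_ kj].
    exact: leq_trans kj _.
  apply/subvP => x xB; have /(subvP near) := xB; rewrite eq_ji => xnear.
  have xnear' : x \in espan A theta' d (fun k => (a <= k.+1)%N && (k <= a.+1)%N).
    by have [_ _ /(_ a ad)] := std'; rewrite -Ea -eq_ji => /subvP; apply.
  have Px : lhorner A P x = 0.
    apply: (espan_eq0 (lhorner_espan P xnear')) => k kd; apply/negP => /andP[ak].
    have /ev[m md Em] : leigenvalue A (theta' k) by apply/ev'; exists k.
    rewrite -Em P0 ?eqxx //; apply: contraTneq ak => m1.
    have -> : k = b by apply: inj' => //; rewrite -Em m1 Eb.
    by move: nab nba nEab; lia.
  have : x \in (W + leigenspace A (theta i.+1))%VS.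
    apply: subvP xnear; apply/subv_sumP => k /andP[_ ki].
    move: ki; rewrite leq_eqVlt => /predU1P[->|ki]; first exact: addvSr.
    by apply: subv_trans (addvSl _ _); apply: leigenspace_espan; rewrite // -ltnS.
  case/memv_addP => y yW [z zE xE]; move: Px; rewrite xE linearD /=.
  have -> : lhorner A P y = 0.
    apply: (espan_eq0 (lhorner_espan P yW)) => k kd; apply/negP => /andP[ki].
    by rewrite P0 ?eqxx // neq_ltn ltnS ki.
  rewrite add0r (lhorner_eigen _ zE) => /eqP; rewrite scaler_eq0 (negbTE Pb) /=.
  by move/eqP->; rewrite addr0.
case: (irr W WA WB) => [W0|W1].
  have [v v0 /negP[]] := std_eigenspace_neq0 std (leq0n d).
  by rewrite -memv0 -W0; apply: (subvP _ _ v0); apply: leigenspace_espan.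
have [v vb /negP[]] := std_eigenspace_neq0 std id.
have vW : v \in W by rewrite W1 memvf.
have : lhorner A P v = 0.
  apply: (espan_eq0 (lhorner_espan P vW)) => k kd; apply/negP => /andP[ki].
  by rewrite P0 ?eqxx // neq_ltn ltnS ki.
by rewrite (lhorner_eigen _ vb) => /eqP; rewrite scaler_eq0 (negbTE Pb).
Qed.

Lemma standard_ordering_unique A B d theta theta' :
  ldiagonalizable A -> irreducible_pair A B ->
  standard_ordering A B d theta -> standard_ordering A B d theta' ->
  (forall i, (i <= d)%N -> theta i = theta' i) \/
  (forall i, (i <= d)%N -> theta i = theta' (d - i)%N).
Proof.
move=> diagA irr std std'; have [inj ev _] := std; have [inj' ev' _] := std'.
have : forall i : 'I_d.+1, exists k : 'I_d.+1, theta i = theta' k.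
  move=> i; have /ev'[k kd E] : leigenvalue A (theta i).
    by apply/ev; exists (i : nat); rewrite // -ltnS.
  by exists (inord k); rewrite inordK.
case/fin_all_exists => f Hf; pose p i : nat := f (inord i).
have pE i : (i <= d)%N -> theta i = theta' (p i) by move=> id; rewrite -Hf inordK.
have pd i : (p i <= d)%N by rewrite -ltnS ltn_ord.
case: (@unit_steps_monotone d p) => // [i j id jd E|i id|H|H].
- by apply: inj => //; rewrite !pE // E.
- by apply: (standard_ordering_adjacent diagA irr std std' id); rewrite ?pE // ltnW.
- by left=> i id; rewrite pE // H.
by right=> i id; rewrite pE // H.
Qed.

End StandardOrderings.
(** * The coefficients of a type I eigenvalue sequence *)

Section Coefficients.
Variables (F : fieldType) (q : F).
Hypotheses (q_neq0 : q != 0) (q_nroot1 : forall n : nat, (0 < n)%N -> q ^+ n != 1).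

Lemma qpow_diff_neq0 j : (0 < j)%N -> q ^+ j - q ^- j != 0.
Proof.
move=> j0; rewrite subr_eq0; apply: contraNneq (q_nroot1 (n := j * 2) _) => [E|].
  by rewrite exprM expr2 {1}E mulVf // expf_neq0.
by rewrite muln_gt0 j0.
Qed.

(** Three consecutive values suffice because 1, Q and Q^-1 are distinct. *)
Lemma exponential_independent (x Q a b c : F) : x != 0 -> Q != 0 -> Q != 1 -> Q ^+ 2 != 1 ->
  (forall i, (i <= 2)%N -> a + b * (x * Q ^+ i) + c * (x^-1 * Q ^- i) = 0) ->
  b = 0 /\ c = 0.
Proof.
move=> x0 Q0 Q1 Q21 H; have H0 := H 0%N isT; have H1 := H 1%N isT; have H2 := H 2%N isT.
have c0 : c = 0.
  have : c * ((Q - 1) * (Q ^+ 2 - 1) / (x * Q ^+ 2)) = 0.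
    rewrite expr0 expr1 in H0 H1.
    (* This combination of the equations at i = 0, 1, 2 eliminates a and b. *)
    transitivity (Q * ((a + b * (x * 1) + c * (x^-1 * 1^-1))
       - (a + b * (x * Q) + c * (x^-1 * Q^-1)))
       - ((a + b * (x * Q) + c * (x^-1 * Q^-1))
       - (a + b * (x * Q ^+ 2) + c * (x^-1 * Q ^- 2)))); last by rewrite H0 H1 H2; ring.
    by field; rewrite Q0 x0 oner_neq0.
  move/eqP; rewrite mulf_eq0 => /orP[/eqP //|]; rewrite !mulf_eq0 invr_eq0 !subr_eq0.
  by rewrite mulf_eq0 expf_eq0 /= (negbTE Q1) (negbTE Q21) (negbTE x0) (negbTE Q0).
split=> //; move: H0 H1; rewrite c0 !mul0r !addr0 expr0 expr1 => H0 H1.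
have : b * (x * (Q - 1)) = 0.
  by transitivity ((a + b * (x * Q)) - (a + b * (x * 1))); [ring | rewrite H0 H1 subrr].
by move/eqP; rewrite !mulf_eq0 subr_eq0 (negbTE x0) (negbTE Q1) !orbF => /eqP.
Qed.

(** For d = 1 the two conventional triples give the values q^-1 and q at i = 0,
    and these differ. *)
Lemma type_I_coefsE d (theta : nat -> F) a b c b0 c0 : (0 < d)%N ->
  (b0 = 1 /\ c0 = 0) \/ (b0 = 0 /\ c0 = 1) ->
  type_I_coefs q d theta a b c ->
  (forall i, (i <= d)%N -> theta i = b0 * qord q d i + c0 * qord q^-1 d i) ->
  b = b0 /\ c = c0.
Proof.
move=> d0 bc0 [thetaE small] eqt.
have q21 : q ^+ 2 != 1 by exact: q_nroot1.
have q0 : q ^+ 2 != 0 by rewrite expf_neq0.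
have qordV i : q ^ (d%:Z - (2 * i)%N%:Z) = qord q^-1 d i.
  by rewrite /qord exprz_inv opprB.
have H i : (i <= d)%N ->
    a + (b - b0) * (q^-1 ^+ d * (q ^+ 2) ^+ i) + (c - c0) * ((q^-1 ^+ d)^-1 * (q ^+ 2) ^- i) = 0.
  move=> id; have := thetaE i id; rewrite eqt // qordV -/(qord q d i) => /eqP.
  rewrite -subr_eq0 -oppr_eq0 => /eqP <-; rewrite !qordE ?invr_eq0 // invrK !exprVn invrK.
  ring.
have [d1|d1] := leqP d 1; last first.
  have [|||||E1 E2] := @exponential_independent (q^-1 ^+ d) (q ^+ 2) a (b - b0) (c - c0).
  - by rewrite expf_neq0 ?invr_eq0.
  - by [].
  - by [].
  - by rewrite -exprM; apply: q_nroot1.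
  - by move=> i i2; apply: H; apply: leq_trans d1.
  by split; apply/eqP; rewrite -subr_eq0; apply/eqP.
have {d0 d1} d1 : d = 1%N by lia.
have := H 0%N (leq0n d); rewrite d1 expr0 expr1 invr1 !mulr1 invrK => E.
have nqV : q^-1 - q != 0.
  by have := qpow_diff_neq0 (j := 1) isT; rewrite expr1 -opprB oppr_eq0.
have q_qV : q - q^-1 != 0 by rewrite -opprB oppr_eq0.
case: small bc0 E => [|[-> -> ->]|[-> -> ->]]; first by rewrite d1.
  case=> -[-> ->] // /eqP; rewrite add0r !subr0 sub0r mul1r mulN1r (negbTE nqV) //.
case=> -[-> ->] // /eqP; rewrite add0r !subr0 sub0r mul1r mulN1r addrC (negbTE q_qV) //.
Qed.

End Coefficients.
(** * Rescaling the Drinfeld polynomial *)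

Section Fractions.
Variables (F : fieldType) (q : F).
Hypotheses (q_neq0 : q != 0) (q_nroot1 : forall n : nat, (0 < n)%N -> q ^+ n != 1).

Let q_qV_neq0 : q - q^-1 != 0.
Proof. by have := qpow_diff_neq0 q_neq0 q_nroot1 (j := 1) isT; rewrite expr1. Qed.

Lemma qfact_neq0 i : qfact q i != 0.
Proof.
rewrite /qfact prodf_seq_neq0; apply/allP => j; rewrite mem_index_iota => /andP[j0 _].
by rewrite mulf_neq0 ?invr_eq0 ?(qpow_diff_neq0 q_neq0).
Qed.

(** The factor q^j - q^-j is [j]_q (q - q^-1). *)
Lemma qpow_diff_prod i d : (i <= d)%N ->
  \prod_(i.+1 <= j < d.+1) (q ^+ j - q ^- j) =
  qfact q d / qfact q i * (q - q^-1) ^+ (d - i).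
Proof.
move=> id; have -> : qfact q d = \prod_(i.+1 <= j < d.+1) qint q j * qfact q i.
  by rewrite mulrC /qfact -big_cat_nat.
rewrite mulfK ?qfact_neq0 //.
have -> : (q - q^-1) ^+ (d - i) = \prod_(i.+1 <= j < d.+1) (q - q^-1).
  by rewrite prodr_const_nat subSS.
by rewrite -big_split /=; apply: eq_bigr => j _; rewrite divfK.
Qed.

Lemma Drinfeld_sum0_fraction d (zeta : nat -> F) :
  tofrac (Drinfeld_sum q d (fun=> 0) zeta) =
    ratC ((-1) ^+ d * qfact q d ^+ 2 * (q - q^-1) ^+ (2 * d)) * ratX F ^+ d *
    (map_poly (@ratC F) (geometric_Drinfeld q d zeta)).[
       (ratX F)^-1 * ratC (q^-1 * (q - q^-1) ^- 2)].
Proof.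
have -> : map_poly (@ratC F) (geometric_Drinfeld q d zeta) =
    \poly_(i < d.+1) ratC ((-1) ^+ i * zeta i * q ^+ i / qfact q i ^+ 2).
  apply/polyP => i; rewrite coef_map_id0 ?coef_poly /ratC ?rmorph0 //.
  by case: ifP => // _; rewrite rmorph0.
rewrite horner_poly mulr_sumr rmorph_sum /=; apply: eq_bigr => -[i /= id] _.
rewrite ltnS in id.
have X0 : ratX F != 0 by rewrite tofrac_eq0 polyX_eq0.
have -> : \prod_(i.+1 <= j < d.+1) (((q ^+ j - q ^- j) ^+ 2)%:P * (0%:P - 'X)) =
    (((qfact q d / qfact q i * (q - q^-1) ^+ (d - i)) ^+ 2) * (-1) ^+ (d - i))%:P
     * 'X ^+ (d - i).
  rewrite -qpow_diff_prod // big_split /= polyCM -mulrA; congr (_ * _).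
    by rewrite -prodrXl rmorph_prod.
  rewrite prodr_const_nat subSS sub0r -['X in LHS]mul1r -mulNr exprMn_comm; last exact: commr_polyX.
  by rewrite rmorphXn rmorphN.
rewrite mulrA -polyCM rmorphM rmorphXn /= -/(ratC _) -/(ratX F).
have ratCM (x y : F) : ratC x * ratC y = ratC (x * y) by rewrite /ratC polyCM rmorphM.
have ratCX (x : F) n : ratC x ^+ n = ratC (x ^+ n) by rewrite /ratC polyC_exp rmorphXn.
have -> : ratX F ^+ (d - i) = ratX F ^+ d * (ratX F ^+ i)^-1.
  by rewrite exprB ?unitfE.
rewrite [((ratX F)^-1 * _) ^+ i]exprMn exprVn ratCX.
have shuffle (a b c e f : {fraction {poly F}}) : a * b * (c * (e * f)) = a * c * f * (b * e).
  by ring.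
rewrite shuffle !ratCM; congr (ratC _ * _).
have := subnKC id; set n := (d - i)%N => dE; have sgn2 : (-1) ^+ i * (-1) ^+ i = 1 :> F.
  by rewrite -exprMn mulrNN mulr1 expr1n.
have Dn2 : (q - q^-1) ^+ (2 * d) = (q - q^-1) ^+ i ^+ 2 * (q - q^-1) ^+ n ^+ 2.
  by rewrite -dE mulnDr exprD ![(2 * _)%N]mulnC !exprM.
rewrite Dn2 -[in (-1) ^+ d]dE exprD.
have wE : (q^-1 * (q - q^-1) ^- 2) ^+ i = (q ^+ i * (q - q^-1) ^+ i ^+ 2)^-1.
  by rewrite exprMn !exprVn -!exprM mulnC invfM.
rewrite wE.
have := expf_neq0 i q_neq0; have := expf_neq0 i q_qV_neq0; have := qfact_neq0 i.
move: (q ^+ i) ((q - q^-1) ^+ i) ((q - q^-1) ^+ n) (qfact q i) (qfact q d) => a b c e f.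
move: sgn2; move: ((-1) ^+ i) ((-1) ^+ n) => s t sgn2 e0 b0 a0.
by rewrite -[LHS]mul1r -sgn2; field; rewrite e0 b0 a0.
Qed.

End Fractions.
(** * Independence of the choice of orderings *)

Lemma qord_inv (F : fieldType) (q : F) d i :
  q ^ (d%:Z - (2 * i)%N%:Z) = qord q^-1 d i.
Proof. by rewrite /qord exprz_inv opprB. Qed.

Lemma qord_rev (F : fieldType) (q : F) d i :
  (i <= d)%N -> qord q d (d - i) = qord q^-1 d i.
Proof. by move=> id; rewrite -qord_inv /qord; congr (_ ^ _); lia. Qed.

Lemma Drinfeld_sumV (F : fieldType) (q : F) d mu zeta :
  Drinfeld_sum q^-1 d mu zeta = Drinfeld_sum q d mu zeta.
Proof.
apply: eq_bigr => i _; congr (_ * _); apply: eq_bigr => j _; congr (_%:P * _).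
by rewrite !exprVn invrK -sqrrN opprB.
Qed.

Lemma eq_Drinfeld_sum (F : fieldType) (q : F) d mu zeta zeta' :
  (forall i, (i <= d)%N -> zeta i = zeta' i) ->
  Drinfeld_sum q d mu zeta = Drinfeld_sum q d mu zeta'.
Proof. by move=> eqz; apply: eq_bigr => i _; rewrite eqz // -ltnS. Qed.

Lemma Drinfeld_sumE (F : fieldType) (q : F) d b c bs cs (mu zeta : nat -> F) :
  (forall j, (0 < j)%N -> (j <= d)%N -> b * bs * q ^ ((2 * j)%N%:Z - (2 * d)%N%:Z)
    + c * cs * q ^ ((2 * d)%N%:Z - (2 * j)%N%:Z) = mu j) ->
  \sum_(i < d.+1) (zeta i)%:P * \prod_(i.+1 <= j < d.+1) phat q d b c bs cs j =
  Drinfeld_sum q d mu zeta.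
Proof.
move=> muE; apply: eq_bigr => i _; congr (_ * _); apply: eq_big_nat => j /andP[ij jd].
by rewrite /phat muE //; apply: leq_ltn_trans ij.
Qed.

Section Main.
Variables (F : closedFieldType) (q : F).
Hypotheses (q_neq0 : q != 0) (q_nroot1 : forall n : nat, (0 < n)%N -> q ^+ n != 1).
Variables (V : vectType F) (A As : 'End(V)) (d : nat).
Hypothesis qgeom : q_geometric q d A As.

Lemma q_geometric_td_system r s : r \in [:: q; q^-1] -> s \in [:: q; q^-1] ->
  td_system A As d (qord r d) (qord s d).
Proof.
have [[_ [[diagA diagAs] _ _ irr]] stdA stdAs] := qgeom.
have std (B C : 'End(V)) r' : standard_ordering B C d (fun i => q ^ (d%:Z - (2 * i)%N%:Z)) ->
    r' \in [:: q; q^-1] -> standard_ordering B C d (qord r' d).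
  move=> stdB; rewrite !inE => /orP[]/eqP->; last first.
    by apply: standard_ordering_eq stdB => i _; rewrite qord_inv.
  apply: standard_ordering_eq (standard_ordering_rev stdB) => i id.
  by rewrite qord_inv qord_rev // invrK.
by move=> rq sq; split=> //; apply: std.
Qed.

Lemma q_geometric_orderings (B C : 'End(V)) theta : ldiagonalizable B -> irreducible_pair B C ->
  standard_ordering B C d (qord q d) -> standard_ordering B C d theta ->
  exists2 r, r \in [:: q; q^-1] & forall i, (i <= d)%N -> theta i = qord r d i.
Proof.
move=> diagB irr stdq std.
case: (standard_ordering_unique diagB irr std stdq) => E.
  by exists q; rewrite // !inE eqxx.
by exists q^-1; rewrite ?inE ?eqxx ?orbT // => i id; rewrite E // qord_rev.
Qed.

(** Among the four choices, (q, q) and (q^-1, q^-1) differ from (q, q^-1) by one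
    reversal each, that of theta* for the first and that of theta for the second.
    For (q^-1, q) two reversals are needed, and the intermediate split sequence is
    obtained from [split_reorder_exists]. *)
Lemma Drinfeld_sum_invariant r s zeta zeta' :
  r \in [:: q; q^-1] -> s \in [:: q; q^-1] ->
  split_sequence A As d (qord q d) (qord q^-1 d) zeta ->
  split_sequence A As d (qord r d) (qord s d) zeta' ->
  Drinfeld_sum q d (fun j => if r == s then (s^-1 ^+ 2) ^+ (d - j) else 0) zeta' =
  Drinfeld_sum q d (fun=> 0) zeta.
Proof.
have qq : q \in [:: q; q^-1] by rewrite !inE eqxx.
have qV : q^-1 \in [:: q; q^-1] by rewrite !inE eqxx orbT.
have nqV : q != q^-1.
  have := qpow_diff_neq0 q_neq0 q_nroot1 (j := 1) isT.
  by rewrite expr1 subr_eq0.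
have qV0 : q^-1 != 0 by rewrite invr_eq0.
have td r' s' := @q_geometric_td_system r' s'.
have tdd r' s' r'q s'q := td_system_dual (td r' s' r'q s'q).
move=> rq sq sp; have spd := split_dual (td _ _ qq qV) sp.
have same z : split_sequence A As d (qord q d) (qord q d) z ->
    Drinfeld_sum q d (fun=> 0) zeta =
    Drinfeld_sum q d (fun j => (q^-1 ^+ 2) ^+ (d - j)) z.
  move/(split_dual (td _ _ qq qq)).
  exact: (Drinfeld_sum_reverse q_neq0 (tdd _ _ qq qV) (tdd _ _ qq qq) spd).
move: rq sq; rewrite !inE => /orP[]/eqP-> /orP[]/eqP-> sp'.
- by rewrite eqxx (same _ sp').
- rewrite (negbTE nqV); apply: eq_Drinfeld_sum => i id.
  by have [_ _ stds _] := td _ _ qq qV; apply: (split_uniq stds sp' sp).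
- rewrite eq_sym (negbTE nqV).
  have [z spz] := split_reorder_exists (tdd _ _ qq qV) (tdd _ _ qq qq) spd.
  have {}spz := split_dual (tdd _ _ qq qq) spz.
  by rewrite (same _ spz); apply: (Drinfeld_sum_reverse q_neq0 (td _ _ qV qq) (td _ _ qq qq)).
rewrite eqxx -(Drinfeld_sumV q _ (fun=> 0)) -Drinfeld_sumV; symmetry.
apply: (Drinfeld_sum_reverse qV0 _ (td _ _ qV qV) _ sp'); rewrite invrK //.
exact: td.
Qed.

End Main.

Lemma type_I_qord (F : fieldType) (q : F) d (theta : nat -> F) r a b c :
  q != 0 -> (forall n : nat, (0 < n)%N -> q ^+ n != 1) -> (0 < d)%N ->
  r \in [:: q; q^-1] -> (forall i, (i <= d)%N -> theta i = qord r d i) ->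
  type_I_coefs q d theta a b c -> b = (r == q)%:R /\ c = (r == q^-1)%:R.
Proof.
move=> q0 q1 d0 rq thE tI.
have nqV : q != q^-1.
  by have := qpow_diff_neq0 q0 q1 (j := 1) isT; rewrite expr1 subr_eq0.
move: rq thE; rewrite !inE => /orP[]/eqP-> thE.
  rewrite eqxx (negbTE nqV); apply: (type_I_coefsE q0 q1 d0 _ tI); first by left.
  by move=> i id; rewrite thE // mul1r mul0r addr0.
rewrite eqxx eq_sym (negbTE nqV); apply: (type_I_coefsE q0 q1 d0 _ tI); first by right.
by move=> i id; rewrite thE // mul1r mul0r add0r.
Qed.

Theorem theorem13p6
  (F : closedFieldType) (charF0 : [pchar F] =i pred0)
  (q : F) (q_neq0 : q != 0)
  (q_nroot1 : forall n : nat, (0 < n)%N -> q ^+ n != 1)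
  (V : vectType F) (A As : 'End(V)) (d : nat)
  (qgeom : q_geometric q d A As)
  (Phat : {poly F}) (PhatP : normalized_Drinfeld q d A As Phat)
  (zeta : nat -> F)
  (zetaP : split_sequence A As d
             (fun i => q ^ ((2 * i)%N%:Z - d%:Z))
             (fun i => q ^ (d%:Z - (2 * i)%N%:Z)) zeta) :
  tofrac Phat =
    ratC ((-1) ^+ d * qfact q d ^+ 2 * (q - q^-1) ^+ (2 * d)) * ratX F ^+ d *
    (map_poly (@ratC F) (geometric_Drinfeld q d zeta)).[
       (ratX F)^-1 * ratC (q^-1 * (q - q^-1) ^- 2)].
Proof.
rewrite -Drinfeld_sum0_fraction //; congr tofrac.
have qq : q \in [:: q; q^-1] by rewrite !inE eqxx.
have [[diagA diagAs] stdA stdAs irr] := q_geometric_td_system qgeom qq qq.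
have irr' : irreducible_pair As A by move=> W ? ?; apply: irr.
have sp : split_sequence A As d (qord q d) (qord q^-1 d) zeta.
  by apply: split_sequence_eq zetaP => // i _; rewrite qord_inv.
have [th [ths [z [std stds spz [a [b [c [a' [b' [c' [tI tI' ->]]]]]]]]]]] := PhatP.
have [r rq thE] := q_geometric_orderings diagA irr stdA std.
have [s sq thsE] := q_geometric_orderings diagAs irr' stdAs stds.
have {}spz := split_sequence_eq thE thsE spz.
rewrite -(Drinfeld_sum_invariant q_neq0 q_nroot1 qgeom rq sq sp spz).
apply: Drinfeld_sumE => j j0 jd; have d0 := leq_trans j0 jd.
have [-> ->] := type_I_qord q_neq0 q_nroot1 d0 rq thE tI.
have [-> ->] := type_I_qord q_neq0 q_nroot1 d0 sq thsE tI'.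
have nqV : q != q^-1.
  by have := qpow_diff_neq0 q_neq0 q_nroot1 (j := 1) isT; rewrite expr1 subr_eq0.
have powE : q ^ ((2 * d)%N%:Z - (2 * j)%N%:Z) = (q ^+ 2) ^+ (d - j).
  by rewrite subzn ?leq_mul2l // -mulnBr -exprnP exprM.
have powVE : q ^ ((2 * j)%N%:Z - (2 * d)%N%:Z) = (q^-1 ^+ 2) ^+ (d - j).
  by rewrite -opprB -exprz_inv subzn ?leq_mul2l // -mulnBr -exprnP exprM.
move: rq sq; rewrite powE powVE !inE => /orP[]/eqP-> /orP[]/eqP->;
  rewrite ?eqxx ?(negbTE nqV) ?[q^-1 == q]eq_sym ?(negbTE nqV) ?invrK;
  by rewrite ?(mulr0, mul0r, mulr1, mul1r, addr0, add0r).
Qed.
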